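(* Let $g:\mathbb{Z}_{\ge 1}\to\mathbb{Z}$ be a normalised arithmetic function (i.e. $g(1)=1$) such that $g(2)\neq 0$. Then for each natural number $k\ge 0$ there exist natural numbers $n_h(g,k)$ and $n_v(g,k)$ such that the families of polynomials $(A_n^g(X))_n$ as well as $(P_n^g(X))_n$ are (i) horizontally log-concave at $n-k$ for each $n\ge n_h(g,k)$; and (ii) vertically log-concave at each $n\ge n_v(g,k)$ for $n-k$.
   Context: $\mathbb{N}$ denotes the natural numbers including $0$. For $g:\mathbb{Z}_{\ge1}\to\mathbb{Z}$ with $g(1)=1$, the D'Arcais polynomials $P_n^g(X)\in\mathbb{Q}[X]$ are defined by the formal power series identity $$\sum_{n=0}^\infty P_n^g(X)q^n=\exp\left(X\sum_{n=1}^\infty g(n)\frac{q^n}{n}\right),$$ equivalently $P_0^g(X)=1$ and $P_n^g(X)=\frac{X}{n}\sum_{m=1}^n g(m)P_{n-m}^g(X)$ for $n\ge1$. Each $P_n^g$ has degree $n$. Put $A_n^g(X):=n!\,P_n^g(X)\in\mathbb{Z}[X]$. For a sequence $(F_n(X))_{n\in\mathbb{N}}\subset\mathbb{R}[X]$ with $F_n(X)=\sum_k f_n(k)X^k$ (coefficients beyond the degree are $0$): - it is horizontally log-concave at $k\in\mathbb{N}\setminus\{0\}$ for $n\in\mathbb{N}$ if $f_n(k)^2\ge f_n(k+1)f_n(k-1)$; - it is vertically log-concave at $n\in\mathbb{N}\setminus\{0\}$ for $k\in\mathbb{N}$ if $f_n(k)^2\ge f_{n+1}(k)f_{n-1}(k)$.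 Thus (i) says $f_n(n-k)^2\ge f_n(n-k+1)f_n(n-k-1)$ and (ii) says $f_n(n-k)^2\ge f_{n+1}(n-k)f_{n-1}(n-k)$, where $f_n(j)$ is the coefficient of $X^j$ in $A_n^g$, respectively in $P_n^g$. *)

(* Defs.v *)
From HB Require Import structures.
From mathcomp Require Import all_boot all_order all_algebra.
From mathcomp Require Import ring zify.

Set Implicit Arguments.
Unset Strict Implicit.
Unset Printing Implicit Defensive.

Import Order.TTheory GRing.Theory Num.Theory.
Local Open Scope ring_scope.

(* A formal power series in q over a ring R is its sequence of coefficients
   nat -> R. *)
Section FormalPowerSeries.
Variable R : comNzRingType.
Implicit Types F G : nat -> R.

Definition fps_one : nat -> R := fun n => (n == 0%N)%:R.

Definition fps_mul F G : nat -> R :=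
  fun n => \sum_(i < n.+1) F i * G (n - i)%N.

Definition fps_pow F (j : nat) : nat -> R := iter j (fps_mul F) fps_one.

End FormalPowerSeries.

(* exp F = \sum_j F^j / j!, for F with zero constant term only: then F^j has
   no term of degree < j, so the terms j > n do not contribute to the
   coefficient of q^n. *)
Definition fps_exp (F : nat -> {poly rat}) : nat -> {poly rat} :=
  fun n => \sum_(j < n.+1) (j`!%:R)^-1 *: fps_pow F j n.

(* X * \sum_(m >= 1) g(m) q^m / m.  The value g 0 is not used, so that
   g : nat -> int stands for a function on the positive integers. *)
Definition darcais_exponent (g : nat -> int) : nat -> {poly rat} :=
  fun m => if m is 0 then 0 else ((g m)%:~R / m%:R) *: 'X.

Definition darcais (g : nat -> int) : nat -> {poly rat} :=
  fps_exp (darcais_exponent g).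

Definition darcaisA (g : nat -> int) : nat -> {poly rat} :=
  fun n => n`!%:R *: darcais g n.

Definition horizontally_log_concave_at (R : numDomainType)
    (F : nat -> {poly R}) (k n : nat) : Prop :=
  (0 < k)%N /\ (F n)`_k.+1 * (F n)`_k.-1 <= (F n)`_k ^+ 2.

Definition vertically_log_concave_at (R : numDomainType)
    (F : nat -> {poly R}) (n k : nat) : Prop :=
  (0 < n)%N /\ (F n.+1)`_k * (F n.-1)`_k <= (F n)`_k ^+ 2.

Section Recurrence.

Lemma fps_pow_poly (R : comNzRingType) (F : nat -> R) N j n : (n < N)%N ->
  fps_pow F j n = ((\poly_(i < N) F i) ^+ j)`_n.
Proof.
elim: j n => [|j IHj] n ltnN; first by rewrite expr0 coef1.
rewrite exprS coefM; apply: eq_bigr => i _.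
rewrite -IHj ?(leq_ltn_trans (leq_subr _ _)) // coef_poly.
by rewrite (leq_ltn_trans _ ltnN) // -ltnS.
Qed.

Lemma fps_pow_lt (R : comNzRingType) (F : nat -> R) j n :
  F 0%N = 0 -> (n < j)%N -> fps_pow F j n = 0.
Proof.
move=> F0; elim: j n => // j IHj n ltnj /=.
rewrite /fps_mul big_ord_recl F0 mul0r add0r big1 // => i _.
have lti := ltn_ord i; rewrite -/(fps_pow _ _) IHj ?mulr0 //= /bump /=; lia.
Qed.

Lemma darcais0 g : darcais g 0 = 1.
Proof. by rewrite /darcais /fps_exp big_ord1 /= fact0 invr1 scale1r. Qed.

Lemma darcaisS g n :
  darcais g n.+1 =
    (n.+1%:R)^-1 *: ('X * \sum_(m < n.+1) (g m.+1)%:~R *: darcais g (n - m)%N).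
Proof.
set E := darcais_exponent g.
have E0 : E 0%N = 0 by [].
pose S := \poly_(i < n.+2) E i.
have defS m j : (m < n.+2)%N -> fps_pow E j m = (S ^+ j)`_m.
  exact: fps_pow_poly.
have darcaisE m : (m <= n)%N ->
    darcais g m = \sum_(j < n.+1) (j`!%:R)^-1 *: (S ^+ j)`_m.
  move=> lemn; rewrite /darcais /fps_exp.
  rewrite (big_ord_widen n.+1 (fun j => (j`!%:R)^-1 *: fps_pow E j m)) //.
  rewrite big_mkcond; apply: eq_bigr => j _ /=.
  rewrite -defS ?ltnS ?leqW //; case: ltnP => // ltmj.
  by rewrite fps_pow_lt ?scaler0.
have derS m : (m < n.+1)%N -> S^`()`_m = (g m.+1)%:~R *: 'X.
  move=> ltm; rewrite coef_deriv coef_poly ltnS ltm /= -scaler_nat scalerA.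
  by rewrite mulrCA mulfV ?mulr1 // pnatr_eq0.
apply: (@scalerI _ _ (n.+1%:R : rat)); first by rewrite pnatr_eq0.
rewrite scalerA mulfV ?pnatr_eq0 // scale1r {1}/darcais /fps_exp -/E.
rewrite big_ord_recl /= /fps_one /= scaler0 add0r scaler_sumr.
transitivity (\sum_(j < n.+1) (j`!%:R)^-1 *: (S^`() * S ^+ j)`_n : {poly rat}).
  apply: eq_bigr => j _; rewrite /bump /= ?add1n; rewrite -[fps_mul _ _]/(fps_pow E j.+1) defS //.
  have := congr1 (fun p : {poly {poly rat}} => p`_n) (deriv_exp S j.+1).
  rewrite coef_deriv coefMn /= -!scaler_nat => coefS.
  rewrite !scalerA mulrC -scalerA coefS scalerA factS natrM; congr (_ *: _).
  by field; rewrite ?pnatr_eq0 -?lt0n ?fact_gt0 //= addrC natr1 pnatr_eq0.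
rewrite mulr_sumr.
under eq_bigr => j _ do rewrite coefM scaler_sumr.
rewrite exchange_big; apply: eq_bigr => m _ /=.
rewrite darcaisE ?leq_subr // -scalerAr mulr_sumr scaler_sumr.
apply: eq_bigr => j _; rewrite derS ?ltn_ord // -!scalerAr -scalerAl.
by rewrite !scalerA mulrC.
Qed.

End Recurrence.

(* Main.v *)
(** Write a_k(n) (below: top_coef g k n) for the coefficient of X^(n-k) in A_n.
    The recurrence gives
      a_k(n+1) - a_k(n) = \sum_(1 <= j <= k) g(j+1) n^_j a_(k-j)(n-j),
    so that in the basis 'C(n, i) the sequence a_k is a polynomial of degree 2k
    in n, with leading term g(2)^k / (2^k k!) n^(2k).  For k > 0 the
    inequalities for A_n thus compare two polynomials of the same degree 4k in
    n, the leading coefficients of which have ratio (k+1)/k > 1; for k = 0 one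
    side vanishes.  The P_n follow since n!^2 <= (n+1)! (n-1)!. *)
Require Import Defs.
From mathcomp Require Import all_boot all_order all_algebra.
From mathcomp Require Import ring lra zify.

Set Implicit Arguments.
Unset Strict Implicit.
Unset Printing Implicit Defensive.

Import Order.TTheory GRing.Theory Num.Theory.
Local Open Scope ring_scope.

(** * Limits with error O(1/n) and asymptotics of polynomial growth *)

(** The bound is imposed at every index, not just eventually, so boundedness is immediate and error
    constants combine without thresholds. *)
Definition lim_rate1 (v : nat -> rat) (c : rat) :=
  exists C, forall n, `|v n - c| <= C / n.+1%:R.

Lemma eq_lim_rate1 v v' c : v =1 v' -> lim_rate1 v c -> lim_rate1 v' c.
Proof. by move=> eqv [C Cv]; exists C => n; rewrite -eqv. Qed.

Lemma lim_rate1_cst c : lim_rate1 (fun=> c) c.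
Proof. by exists 0 => n; rewrite subrr normr0 mul0r. Qed.

Lemma rate1_ge0 (x C : rat) n : `|x| <= C / n.+1%:R -> 0 <= C.
Proof. by move=> /(le_trans (normr_ge0 _)); rewrite pmulr_lge0 // invr_gt0. Qed.

Lemma lim_rate1_bounded v c : lim_rate1 v c -> exists B, forall n, `|v n| <= B.
Proof.
move=> [C Cv]; exists (C + `|c|) => n.
have C0 := rate1_ge0 (Cv n).
rewrite -[v n](subrK c) (le_trans (ler_normD _ _)) // lerD2r.
by rewrite (le_trans (Cv n)) // ler_pdivrMr // ler_peMr // ler1n.
Qed.

Lemma lim_rate1D v w b c :
  lim_rate1 v b -> lim_rate1 w c -> lim_rate1 (fun n => v n + w n) (b + c).
Proof.
move=> [C Cv] [D Dw]; exists (C + D) => n.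
rewrite opprD addrACA mulrDl (le_trans (ler_normD _ _)) //.
exact: lerD.
Qed.

Lemma lim_rate1M v w b c :
  lim_rate1 v b -> lim_rate1 w c -> lim_rate1 (fun n => v n * w n) (b * c).
Proof.
move=> [C Cv] lim_w; have [B Bw] := lim_rate1_bounded lim_w.
case: lim_w => D Dw; exists (C * B + `|b| * D) => n.
have -> : v n * w n - b * c = (v n - b) * w n + b * (w n - c) by ring.
rewrite [leRHS]mulrDl (le_trans (ler_normD _ _)) // !normrM lerD //.
  by rewrite mulrAC ler_pM.
by rewrite -mulrA ler_wpM2l.
Qed.

Lemma lim_rate1X v c d :
  lim_rate1 v c -> lim_rate1 (fun n => v n ^+ d) (c ^+ d).
Proof.
move=> lim_v; elim: d => [|d IHd]; first exact: lim_rate1_cst.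
rewrite exprS; apply: eq_lim_rate1 (lim_rate1M lim_v IHd) => n.
by rewrite exprS.
Qed.

Lemma lim_rate1_shift v c : lim_rate1 v c -> lim_rate1 (v \o succn) c.
Proof.
move=> [C Cv]; exists C => n /=; rewrite (le_trans (Cv _)) //.
rewrite ler_wpM2l ?(rate1_ge0 (Cv n)) // lef_pV2 ?posrE ?ltr0n //.
by rewrite ler_nat.
Qed.

Lemma lim_rate1_gt0 v c :
  lim_rate1 v c -> 0 < c -> exists N, forall n, (N <= n)%N -> 0 <= v n.
Proof.
(* From index [C / c] on, the error [C / n.+1%:R] is at most [c]. *)
move=> [C Cv] c_gt0; exists (Num.bound (C / c)) => n leNn.
have C0 := rate1_ge0 (Cv n).
have ltC : C / c < n.+1%:R.
  rewrite (lt_le_trans (archi_boundP _)) ?divr_ge0 ?(ltW c_gt0) //.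
  by rewrite ler_nat leqW.
have leC : C / n.+1%:R <= c.
  by rewrite ler_pdivrMr ?ltr0n // mulrC -ler_pdivrMr // ltW.
by move: (le_trans (Cv n) leC); rewrite ler_norml => /andP[]; lra.
Qed.

(* u n = c n^d + O(n^(d-1)); the shift to n.+1 avoids the division by 0 at
   n = 0. *)
Definition asymp (u : nat -> rat) (d : nat) (c : rat) :=
  lim_rate1 (fun n => u n / n.+1%:R ^+ d) c.

Lemma eq_asymp u u' d c : u =1 u' -> asymp u d c -> asymp u' d c.
Proof. by move=> equ; apply: eq_lim_rate1 => n; rewrite equ. Qed.

Lemma asympD u w d b c :
  asymp u d b -> asymp w d c -> asymp (fun n => u n + w n) d (b + c).
Proof.
move=> asu asw; apply: eq_lim_rate1 (lim_rate1D asu asw) => n.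
by rewrite mulrDl.
Qed.

Lemma asympM u w d e b c :
  asymp u d b -> asymp w e c -> asymp (fun n => u n * w n) (d + e) (b * c).
Proof.
move=> asu asw; apply: eq_lim_rate1 (lim_rate1M asu asw) => n.
by rewrite exprD invfM mulrACA.
Qed.

Lemma asympZ a u d c : asymp u d c -> asymp (fun n => a * u n) d (a * c).
Proof.
have as_a : asymp (fun=> a) 0 a.
  by apply: eq_lim_rate1 (lim_rate1_cst a) => n; rewrite divr1.
by move=> asu; apply: (asympM as_a asu).
Qed.

Lemma asympS u d c : asymp u d c -> asymp u d.+1 0.
Proof.
have lim_inv : lim_rate1 (fun n => n.+1%:R^-1) 0.
  by exists 1 => n; rewrite subr0 mul1r ger0_norm // invr_ge0.
move=> asu; rewrite /asymp -(mulr0 c).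
apply: eq_lim_rate1 (lim_rate1M asu lim_inv) => n.
by rewrite exprSr invfM mulrA.
Qed.

Lemma asymp_shift u d c : asymp u d c -> asymp (u \o succn) d c.
Proof.
move=> asu; have lim_ratio : lim_rate1 (fun n => n.+2%:R / n.+1%:R) 1.
  exists 1 => n; have -> : n.+2%:R / n.+1%:R - 1 = 1 / n.+1%:R :> rat.
    by rewrite -[n.+2%:R]natr1; field; rewrite addrC natr1 pnatr_eq0.
  by rewrite ger0_norm // divr_ge0.
have lim_pow := lim_rate1X d lim_ratio; rewrite expr1n in lim_pow.
rewrite /asymp -(mulr1 c).
apply: eq_lim_rate1 (lim_rate1M (lim_rate1_shift asu) lim_pow) => n /=.
by rewrite expr_div_n mulrA divfK // expf_neq0 // pnatr_eq0.
Qed.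

Lemma asymp_shiftn s u d c : asymp u d c -> asymp (fun n => u (n + s)%N) d c.
Proof.
move=> asu; elim: s => [|s IHs].
  by apply: eq_asymp asu => n; rewrite addn0.
by apply: eq_asymp (asymp_shift IHs) => n /=; rewrite addSnnS.
Qed.

(** Induction through (i+1) C(n,i+1) = (n-i) C(n,i). *)
Lemma asymp_bin i : asymp (fun n => 'C(n, i)%:R) i i`!%:R^-1.
Proof.
elim: i => [|i IHi].
  by apply: eq_lim_rate1 (lim_rate1_cst 1) => n; rewrite bin0 divr1.
have as_sub : asymp (fun n => n%:R - i%:R) 1 1.
  exists i.+1%:R => n.
  have -> : (n%:R - i%:R) / n.+1%:R ^+ 1 - 1 = - (i.+1%:R / n.+1%:R) :> rat.
    by rewrite -!natr1; field; rewrite natr1 pnatr_eq0.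
  by rewrite normrN ger0_norm // divr_ge0.
have := asympZ i.+1%:R^-1 (asympM as_sub IHi).
rewrite mul1r -invfM -natrM -factS; apply: eq_asymp => n.
apply: (@mulfI _ i.+1%:R); first by rewrite pnatr_eq0.
rewrite mulVKf ?pnatr_eq0 // -natrM mul_bin_left.
(* For n < i the natural difference truncates and the rational one is negative, but C(n,i) = 0 kills
   both sides. *)
case: (leqP i n) => [lein|ltni]; first by rewrite natrM natrB.
by rewrite bin_small // muln0 mulr0.
Qed.

(** * Newton expansions in the basis of binomial coefficients *)

(** Here [c] is d! times the coefficient of n^d; it may be 0, so [d] only bounds the degree. *)
Definition newton_poly (u : nat -> rat) (d : nat) (c : rat) :=
  exists2 e : nat -> rat, e d = c
    & forall n, u n = \sum_(i < d.+1) e i * 'C(n, i)%:R.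

Lemma eq_newton_poly u u' d c :
  u =1 u' -> newton_poly u d c -> newton_poly u' d c.
Proof. by move=> equ [e ed eu]; exists e => // n; rewrite -equ. Qed.

Lemma newton_poly0 d : newton_poly (fun=> 0) d 0.
Proof. by exists (fun=> 0) => // n; rewrite big1 // => i _; rewrite mul0r. Qed.

Lemma newton_polyD u w d b c :
  newton_poly u d b -> newton_poly w d c ->
  newton_poly (fun n => u n + w n) d (b + c).
Proof.
move=> [e ed eu] [f fd fw]; exists (fun i => e i + f i) => [|n].
  by rewrite ed fd.
by rewrite eu fw -big_split; apply: eq_bigr => i _; rewrite mulrDl.
Qed.

Lemma newton_polyZ a u d c :
  newton_poly u d c -> newton_poly (fun n => a * u n) d (a * c).
Proof.
move=> [e ed eu]; exists (fun i => a * e i) => [|n]; first by rewrite ed.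
by rewrite eu mulr_sumr; apply: eq_bigr => i _; rewrite mulrA.
Qed.

Lemma newton_polyW u d d' c :
  (d < d')%N -> newton_poly u d c -> newton_poly u d' 0.
Proof.
move=> ltd [e _ eu]; exists (fun i => if (i < d.+1)%N then e i else 0).
  by rewrite ltnNge ltd.
move=> n; rewrite eu.
rewrite (big_ord_widen d'.+1 (fun i => e i * 'C(n, i)%:R)) ?ltnS 1?ltnW //.
by rewrite big_mkcond; apply: eq_bigr => i _; case: ifP => // _; rewrite mul0r.
Qed.

Lemma newton_poly_sum (I : Type) (r : seq I) (P : pred I)
    (u : I -> nat -> rat) d :
  (forall i, P i -> newton_poly (u i) d 0) ->
  newton_poly (fun n => \sum_(i <- r | P i) u i n) d 0.
Proof.
move=> Nu; elim: r => [|i r IHr].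
  by apply: eq_newton_poly (newton_poly0 d) => n; rewrite big_nil.
case Pi: (P i); last first.
  by apply: eq_newton_poly IHr => n; rewrite big_cons Pi.
have := newton_polyD (Nu _ Pi) IHr; rewrite addr0.
by apply: eq_newton_poly => n; rewrite big_cons Pi.
Qed.

(** Absorption: n C(n-1,i) = (i+1) C(n,i+1). At n = 0 the factor n hides the truncated
    predecessor. *)
Lemma newton_poly_mul_pred u d c :
  newton_poly u d c ->
  newton_poly (fun n => n%:R * u n.-1) d.+1 (d.+1%:R * c).
Proof.
move=> [e ed eu].
exists (fun i => if i is i'.+1 then i%:R * e i' else 0) => [|n].
  by rewrite ed.
rewrite big_ord_recl mul0r add0r eu mulr_sumr; apply: eq_bigr => i _ /=.
by rewrite mulrCA -natrM mul_bin_diag natrM mulrCA mulrA.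
Qed.


(** By Pascal's rule C(n,i+1) has forward difference C(n,i), so summation merely shifts the
    coefficients by one; this motivates the Newton basis. *)
Lemma newton_poly_antidiff u w d c :
  u 0%N = 0 -> (forall n, u n.+1 = u n + w n) -> newton_poly w d c ->
  newton_poly u d.+1 c.
Proof.
move=> u0 uS [e ed ew]; exists (fun i => if i is i'.+1 then e i' else 0) => //.
move=> n; rewrite big_ord_recl mul0r add0r /=; elim: n => [|n IHn].
  by rewrite u0 big1 // => i _; rewrite mulr0.
rewrite uS IHn ew -big_split; apply: eq_bigr => i _ /=.
by rewrite binS natrD mulrDr.
Qed.

Lemma newton_poly_asymp u d c : newton_poly u d c -> asymp u d (c / d`!%:R).
Proof.
move=> [e <- eu]; apply: eq_asymp (fsym eu) _.
elim: d {u c eu} => [|d IHd].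
  by apply: eq_asymp (asympZ (e 0%N) (asymp_bin 0)) => n; rewrite big_ord1.
have := asympD (asympS IHd) (asympZ (e d.+1) (asymp_bin d.+1)).
by rewrite add0r; apply: eq_asymp => n; rewrite [RHS]big_ord_recr.
Qed.

Lemma newton_poly_ffact j u d c :
  newton_poly u d c ->
  newton_poly (fun n => (n ^_ j)%:R * u (n - j)%N) (d + j)
    (((d + j) ^_ j)%:R * c).
Proof.
move=> Nu; elim: j => [|j IHj].
  by rewrite addn0 mul1r; apply: eq_newton_poly Nu => n; rewrite mul1r subn0.
rewrite addnS ffactSS natrM -mulrA.
apply: eq_newton_poly (newton_poly_mul_pred IHj) => n.
by rewrite ffactnS natrM mulrA; congr (_ * u _); lia.
Qed.

(** * Coefficients of A_n counted from the top degree *)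

Lemma size_darcais g n : (size (darcais g n) <= n.+1)%N.
Proof.
elim/ltn_ind: n => -[|n] IHn; first by rewrite darcais0 size_poly1.
rewrite darcaisS (leq_trans (size_scale_leq _ _)) // mulrC.
apply: leq_trans (size_polyMleq _ _) _; rewrite size_polyX addn2 ltnS.
apply: leq_trans (size_sum _ _ _) _; apply/bigmax_leqP => i _.
by rewrite (leq_trans (size_scale_leq _ _)) // (leq_trans (IHn _ _)) //; lia.
Qed.

Lemma darcaisAS g n :
  darcaisA g n.+1 =
    'X * \sum_(m < n.+1) ((g m.+1)%:~R * (n ^_ m)%:R) *: darcaisA g (n - m)%N.
Proof.
rewrite /darcaisA darcaisS scalerA factS mulnC natrM mulfK ?pnatr_eq0 //.
rewrite scalerAr scaler_sumr; congr (_ * _); apply: eq_bigr => m _.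
rewrite !scalerA; congr (_ *: _).
by rewrite -mulrA -natrM ffact_fact 1?mulrC // -ltnS.
Qed.

(** Without the guard, the truncated [n - k] would read the constant coefficient when n < k. The
    value 0 also supplies the initial condition of [newton_poly_antidiff]. *)
Definition top_coef (g : nat -> int) (k n : nat) : rat :=
  if (k <= n)%N then (darcaisA g n)`_(n - k) else 0.

Lemma darcaisA_coef_gt g n i : (n < i)%N -> (darcaisA g n)`_i = 0.
Proof.
move=> ltni; rewrite /darcaisA coefZ nth_default ?mulr0 //.
exact: leq_trans (size_darcais g n) ltni.
Qed.

(** Compare coefficients of X^(n+1-k) in [darcaisAS]: the terms j > k drop out, since A_(n-j) has
    degree at most n-j < n-k. *)
Lemma top_coefS g k n :
  top_coef g k n.+1 =
    \sum_(j < k.+1)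
      ((g j.+1)%:~R * (n ^_ j)%:R) * top_coef g (k - j) (n - j).
Proof.
rewrite /top_coef; case: (leqP k n) => [lekn|ltnk]; last first.
  rewrite big1 => [|j _]; last first.
    have [lejn|ltnj] := leqP j n; last by rewrite ffact_small // mulr0 mul0r.
    by rewrite ifN ?mulr0 // -ltnNge; have := ltn_ord j; lia.
  (* Only k = n+1 is left: the constant coefficient, which is 0 because of the factor X. *)
  case: leqP => // lekn; have -> : k = n.+1 by lia.
  by rewrite subnn darcaisAS coefXM.
rewrite leqW // subSn // darcaisAS coefXM /= coef_sum.
rewrite [RHS](big_ord_widen n.+1 (fun j => ((g j.+1)%:~R * (n ^_ j)%:R) *
  (if (k - j <= n - j)%N
   then (darcaisA g (n - j))`_(n - j - (k - j)) else 0))) //.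
rewrite [RHS]big_mkcond; apply: eq_bigr => j _ /=; rewrite coefZ.
have ltjn := ltn_ord j.
case: ifP => [lejk|/negbT]; last first.
  by rewrite -ltnNge => ltkj; rewrite darcaisA_coef_gt ?mulr0 //; lia.
by rewrite ifT; [congr (_ * _`_ _); lia | lia].
Qed.

(** The constant is g(2)^k (2k-1)!!. As g(1) = 1, the term j = 0 of [top_coefS] is a_k(n) itself,
    which leaves a difference equation to sum. *)
Lemma top_coef_newton g k :
  g 1%N = 1 ->
  newton_poly (top_coef g k) k.*2
    ((g 2%N)%:~R ^+ k * (k.*2)`!%:R / (2 ^+ k * k`!%:R)).
Proof.
move=> g1; elim/ltn_ind: k => -[|k] IHk.
  (* For k = 0: A_n is monic. *)
  exists (fun=> 1) => // n.
  rewrite big_ord1 bin0 mulr1; elim: n => [|n IHn].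
    by rewrite /top_coef /darcaisA darcais0 fact0 scale1r coef1.
  by rewrite top_coefS big_ord1 g1 !subn0 IHn ffactn0 !mulr1.
pose term j n := ((g j.+1)%:~R * (n ^_ j)%:R) * top_coef g (k.+1 - j) (n - j).
have Nterm i j c : (i + j = k.+1)%N -> newton_poly (top_coef g i) i.*2 c ->
    newton_poly (term j) (i.*2 + j)
      ((g j.+1)%:~R * (((i.*2 + j) ^_ j)%:R * c)).
  move=> def_k /(newton_poly_ffact j)/(newton_polyZ (g j.+1)%:~R).
  by apply: eq_newton_poly => n; rewrite /term -def_k addnK mulrA.
(* For a_(k+1), term j has degree at most 2k+2-j, so j = 1 alone reaches degree 2k+1; it multiplies
   the constant by g(2)(2k+1). *)
have N1 := Nterm k 1%N _ (addn1 k) (IHk _ (ltnSn k)).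
have Nrest : newton_poly (fun n => \sum_(j < k) term j.+2 n) k.*2.+1 0.
  apply: newton_poly_sum => j _; have ltjk := ltn_ord j.
  have lt1 : (k.+1 - j.+2 < k.+1)%N by lia.
  by apply: newton_polyW (Nterm _ j.+2 _ _ (IHk _ lt1)); lia.
rewrite doubleS.
apply: (newton_poly_antidiff (w := fun n => \sum_(j < k.+1) term j.+1 n)).
- by rewrite /top_coef.
- move=> n; rewrite top_coefS big_ord_recl g1 ffactn0 !subn0 !mul1r.
  by congr (_ + _).
rewrite addn1 ffactn1 in N1.
have := newton_polyD N1 Nrest; rewrite addr0.
have -> : (g 2%N)%:~R * (k.*2.+1%:R *
     ((g 2%N)%:~R ^+ k * (k.*2)`!%:R / (2 ^+ k * k`!%:R))) =
  (g 2%N)%:~R ^+ k.+1 * (k.*2.+2)`!%:R / (2 ^+ k.+1 * (k.+1)`!%:R) :> rat.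
  have -> : (k.*2.+2)`!%:R = 2 * k.+1%:R * k.*2.+1%:R * (k.*2)`!%:R :> rat.
    by rewrite !factS -!natrM -doubleS -mul2n !mulnA.
  rewrite factS !exprS natrM.
  field; rewrite ?pnatr_eq0 -?lt0n ?fact_gt0 ?expf_neq0 //=.
  by rewrite addrC natr1 pnatr_eq0.
by apply: eq_newton_poly => n; rewrite big_ord_recl.
Qed.

Lemma top_coef_asymp g k :
  g 1%N = 1 ->
  asymp (top_coef g k) k.*2 (((g 2%N)%:~R / 2) ^+ k / k`!%:R).
Proof.
move=> g1; have := newton_poly_asymp (top_coef_newton k g1).
congr asymp; rewrite expr_div_n.
by field; rewrite ?pnatr_eq0 -?lt0n ?fact_gt0 ?expf_neq0.
Qed.

(** The shift s = 0 serves the horizontal inequality, s = 1 the vertical one; shifts leave leading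
    terms unchanged. *)
Lemma top_coef_log_concave g k s :
  g 1%N = 1 -> g 2%N <> 0 ->
  exists N, forall n, (N <= n)%N ->
    top_coef g k.+2 (n + s + s) * top_coef g k n
      <= top_coef g k.+1 (n + s) ^+ 2.
Proof.
move=> g1 /eqP g2; pose x : rat := (g 2%N)%:~R / 2.
have x0 : x != 0 by rewrite mulf_neq0 // intr_eq0.
have as_sq := asymp_shiftn s (top_coef_asymp k.+1 g1).
have as_top := asymp_shiftn s (asymp_shiftn s (top_coef_asymp k.+2 g1)).
have as_prod := asympZ (-1) (asympM as_top (top_coef_asymp k g1)).
have deg : (k.+2.*2 + k.*2 = k.+1.*2 + k.+1.*2)%N by lia.
rewrite deg in as_prod.
have [|N posN] := lim_rate1_gt0 (asympD (asympM as_sq as_sq) as_prod).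
  rewrite -/x.
  (* The factor 1/(k+2) is 1 - (k+1)/(k+2); the rest is a nonzero square as g(2) is nonzero,
     whatever its sign. *)
  have -> : x ^+ k.+1 / (k.+1)`!%:R * (x ^+ k.+1 / (k.+1)`!%:R) +
      -1 * (x ^+ k.+2 / (k.+2)`!%:R * (x ^+ k / k`!%:R)) =
      (x ^+ k.+1 / k.+1`!%:R) ^+ 2 / k.+2%:R :> rat.
    rewrite !factS !exprS !natrM -[k.+2%:R]natr1.
    field; rewrite ?pnatr_eq0 -?lt0n ?fact_gt0 //=.
    by rewrite nat1r natr1 !pnatr_eq0.
  rewrite divr_gt0 ?ltr0n // exprn_even_gt0 //=.
  by rewrite mulf_neq0 ?expf_neq0 // invr_eq0 pnatr_eq0 -lt0n fact_gt0.
exists N => n /posN; rewrite pmulr_lge0; last by rewrite invr_gt0 exprn_gt0.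
by rewrite mulN1r subr_ge0 expr2.
Qed.

(** * Transfer from A_n to P_n, and conclusion *)

Lemma darcais_coef g n i : (darcais g n)`_i = n`!%:R^-1 * (darcaisA g n)`_i.
Proof. by rewrite coefZ mulKf // pnatr_eq0 -lt0n fact_gt0. Qed.

Lemma horizontally_log_concave_darcais g k n :
  horizontally_log_concave_at (darcaisA g) k n ->
  horizontally_log_concave_at (darcais g) k n.
Proof.
case=> k0 leA; split=> //; rewrite !darcais_coef mulrACA -expr2 exprMn.
by rewrite ler_wpM2l // sqr_ge0.
Qed.

(** Coefficients may be negative, so the inequality for A_n is scaled first; log-convexity of the
    factorial is then applied to the nonnegative square. *)
Lemma vertically_log_concave_darcais g n k :
  vertically_log_concave_at (darcaisA g) n k ->
  vertically_log_concave_at (darcais g) n k.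
Proof.
case: n => [[]//|n] [_ leA]; split=> //=; rewrite !darcais_coef mulrACA exprMn.
have fact0 m : 0 < m`!%:R :> rat by rewrite ltr0n fact_gt0.
apply: (@le_trans _ _ ((n.+2`!%:R^-1 * n`!%:R^-1) * (darcaisA g n.+1)`_k ^+ 2)).
  by rewrite ler_wpM2l // mulr_ge0 // invr_ge0.
rewrite ler_wpM2r ?sqr_ge0 // -invfM expr2 -invfM.
rewrite lef_pV2 ?posrE ?mulr_gt0 // -!natrM ler_nat.
rewrite (factS n.+1) -mulnA (mulnC n.+1`!) mulnA leq_mul //.
by rewrite factS leq_mul.
Qed.

(** The conjunct [k <= n] ensures that [n - k] is a true difference. *)
Theorem theorem2p1 (g : nat -> int) (g1 : g 1%N = 1) (g2 : g 2%N <> 0) (k : nat) :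
  exists nh nv : nat,
    (forall n : nat, (nh <= n)%N ->
       [/\ (k <= n)%N,
           horizontally_log_concave_at (darcaisA g) (n - k) n
         & horizontally_log_concave_at (darcais g) (n - k) n]) /\
    (forall n : nat, (nv <= n)%N ->
       [/\ (k <= n)%N,
           vertically_log_concave_at (darcaisA g) n (n - k)
         & vertically_log_concave_at (darcais g) n (n - k)]).
Proof.
suff [N NP] : exists N, forall n, (N <= n)%N ->
    [/\ (k <= n)%N, horizontally_log_concave_at (darcaisA g) (n - k) n
      & vertically_log_concave_at (darcaisA g) n (n - k)].
  exists N, N; split=> n /NP[lekn hA vA]; split=> //.
    exact: horizontally_log_concave_darcais.
  exact: vertically_log_concave_darcais.
case: k => [|k].
  (* For k = 0 a factor on the smaller side has exponent above the degree: X^(n+1) in A_n, or X^n in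
     A_(n-1). *)
  exists 1%N => n n_gt0; rewrite subn0; split=> //; split=> //.
    by rewrite darcaisA_coef_gt // mul0r sqr_ge0.
  by rewrite [X in _ * X]darcaisA_coef_gt ?mulr0 ?sqr_ge0 // prednK.
have [N0 hN0] := top_coef_log_concave k 0 g1 g2.
have [N1 hN1] := top_coef_log_concave k 1 g1 g2.
(* The summand k+3 makes the exponent n-k-1 positive and satisfies the guards of [top_coef]. *)
exists (N0 + N1 + k).+3 => n len; split; first by lia.
  split; first by lia.
  have /hN0 : (N0 <= n)%N by lia.
  rewrite !addn0 /top_coef !ifT; [|lia..].
  have -> : (n - k.+2 = (n - k.+1).-1)%N by lia.
  have -> : (n - k = (n - k.+1).+1)%N by lia.
  by rewrite mulrC.
split; first by lia.
(* Reindexing n as n+1 makes A_(n-1) the base point of the shift. *)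
case: n len => // n len; have /hN1 : (N1 <= n)%N by lia.
by rewrite !addn1 /top_coef !ifT ?subSS //; lia.
Qed.
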